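(* Let $p>1$, $a>1$, $f(v)=\dfrac{|v|^{p-1}v}{\log^a(2+v^2)}$ and $\kappa_0=\Big(\frac{2(p+1)}{(p-1)^2}\Big)^{\frac1{p-1}}$. Then: (i) There exist $t_0>0$ and $\varphi_0\in C^2([-t_0,0),\mathbb{R})$ such that $\varphi_0''(t)=\varphi_0^p(t)+f(\varphi_0(t))$ on $[-t_0,0)$ and $\varphi_0(t)\sim\kappa_0(-t)^{-\frac{2}{p-1}}$ as $t\to0^-$. (ii) For $T\in\mathbb{R}$, if $\varphi_T(t)=\varphi_0(t-T)$, then $\varphi_T''(t)=\varphi_T^p(t)+f(\varphi_T(t))$, with $\varphi_T(t)\sim\kappa_0(T-t)^{-\frac2{p-1}}$ as $t\to T^-$. (iii) The function $\phi$ associated with $\varphi_T$ in similarity variables is $\phi(s)=e^{-\frac{2s}{p-1}}\varphi_T(T-e^{-s})=e^{-\frac{2s}{p-1}}\varphi_0(-e^{-s})$.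
   Context: The similarity variables transform a function $u(t)$ blowing up at time $T$ into $\phi(s)=(T-t)^{\frac{2}{p-1}}u(t)$ with $s=-\log(T-t)$. The symbol $g\sim h$ means $g/h\to1$ in the indicated limit. *)

(* Defs.v *)
From HB Require Import structures.
From mathcomp Require Import all_boot all_order all_algebra.
From mathcomp Require Import all_classical all_reals all_analysis.

Set Implicit Arguments.
Unset Strict Implicit.
Unset Printing Implicit Defensive.

Import Order.TTheory GRing.Theory Num.Theory.
Import numFieldNormedType.Exports.

Local Open Scope classical_set_scope.
Local Open Scope ring_scope.

Definition asymp_equiv (R : realType) (F : set_system R) (g h : R -> R) : Prop :=
  g x / h x @[x --> F] --> (1 : R).

(* The library has no derivative relative to a set: here the increment stays
   in D, so that at the left endpoint of an interval `[b, c[ the derivative is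
   one-sided. Only the values of u on D matter. *)
Definition diff_quotient (R : realType) (u : R -> R) (t : R) : R -> R :=
  fun x => (u x - u t) / (x - t).

Definition derivable_within (R : realType) (D : set R) (u : R -> R) (t : R) :
  Prop := cvg (diff_quotient u t x @[x --> within D t^']).

Definition derive_within (R : realType) (D : set R) (u : R -> R) (t : R) : R :=
  lim (diff_quotient u t x @[x --> within D t^']).

Definition derive_within_n (R : realType) (D : set R) (n : nat) (u : R -> R) :
  R -> R := iter n (derive_within D) u.

(* u is of class C^n on D, for a set D without isolated points. *)
Definition Cn_on (R : realType) (D : set R) (n : nat) (u : R -> R) : Prop :=
  (forall k : nat, (k < n)%N ->
     forall t, D t -> derivable_within D (derive_within_n D k u) t) /\
  {within D, continuous (derive_within_n D n u)}.

Definition log_perturbation (R : realType) (p a v : R) : R :=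
  `|v| `^ (p - 1) * v / ln (2 + v ^+ 2) `^ a.

Definition kappa0 (R : realType) (p : R) : R :=
  (2 * (p + 1) / (p - 1) ^+ 2) `^ (p - 1)^-1.

(* u'' = u^p + f(u) on D. The real power u^p requires u to be nonnegative;
   powR takes the conventional value 1 at a negative base. *)
Definition solves_ode (R : realType) (p a : R) (D : set R) (u : R -> R) : Prop :=
  forall t, D t ->
    0 <= u t /\
    derive_within_n D 2 u t = u t `^ p + log_perturbation p a (u t).

(* phi(s) = (T - t)^(2/(p-1)) u(t) with s = - log (T - t), for t ranging over
   the domain D of u, a set of times smaller than T. *)
Definition similarity_profile (R : realType) (p T : R) (D : set R)
    (u phi : R -> R) : Prop :=
  forall t, D t -> phi (- ln (T - t)) = (T - t) `^ (2 / (p - 1)) * u t.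

(* Main.v *)
Require Import Defs.
From HB Require Import structures.
From mathcomp Require Import all_boot all_order all_algebra.
From mathcomp Require Import all_classical all_reals all_analysis.
From mathcomp Require Import ring lra.

Set Implicit Arguments.
Unset Strict Implicit.
Unset Printing Implicit Defensive.

Import Order.TTheory GRing.Theory Num.Theory.
Import numFieldNormedType.Exports.

Local Open Scope classical_set_scope.
Local Open Scope ring_scope.

(* Energy conservation with F' = h := u^p + f(u) turns u'' = h(u) into the
   first-order equation u' = sqrt (2 F(u)). In the variable w = u^(-(p-1)/2)
   blow-up becomes w = 0, and w' = - k(w) where
   k(w) = (p-1)/2 * sqrt (2 F(u) / u^(p+1)). Since h(v) ~ v^p at infinity,
   L'Hopital's rule gives F(u) / u^(p+1) -> 1 / (p+1), so k extends to a
   positive continuous function at w = 0. The solution is then the inverse of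
   the proper integral of 1/k from 0 to w, and w(t) ~ k(0) (-t) yields the
   constant kappa0 = k(0)^(-2/(p-1)). *)

(** * Antiderivatives, monotonicity and growth of primitives at infinity *)

Section Calculus.
Variable R : realType.
Implicit Types (f h F : R -> R) (b c x : R).

(** The integral from [b] is differentiable by the fundamental theorem of calculus at points
    strictly to the right of its base point; taking [b = -1] later makes [0] such a point. *)
Lemma continuous_antiderivative f b : continuous f ->
  exists F, forall x, b < x -> is_derive x 1 F (f x).
Proof.
move=> cf; exists (fun x => \int[lebesgue_measure]_(t in `[b, x]) f t) => x bx.
have xx1 : x < x + 1 by rewrite ltrDl.
have fi : lebesgue_measure.-integrable `[b, x + 1] (EFin \o f).
  apply: continuous_compact_integrable; first exact: segment_compact.
  exact: continuous_subspaceT.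
have [dF Fx] := continuous_FTC1_closed xx1 fi bx (cf x).
by apply: DeriveDef => //; rewrite -derive1E.
Qed.

Lemma is_derive_continuous f x l : is_derive x 1 f l -> {for x, continuous f}.
Proof. by move=> [/derivable1_diffP/differentiable_continuous]. Qed.

Lemma is_derive_within_continuous f h b c :
  (forall x, b <= x <= c -> is_derive x 1 f (h x)) ->
  {within `[b, c], continuous f}.
Proof.
move=> df; apply: continuous_in_subspaceT => x; rewrite inE/= in_itv/= => xbc.
exact: is_derive_continuous (df _ xbc).
Qed.

Lemma is_derive_ge0_le f h b c : b <= c ->
  (forall x, b <= x <= c -> is_derive x 1 f (h x)) ->
  (forall x, b < x < c -> 0 <= h x) -> f b <= f c.
Proof.
rewrite le_eqVlt => /predU1P[-> //|bc] df h0.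
have df' x : x \in `]b, c[ -> is_derive x 1 f (h x).
  by rewrite in_itv/= => /andP[bx xc]; apply: df; rewrite !ltW.
have [x xbc E] := MVT bc df' (is_derive_within_continuous df).
by rewrite -subr_ge0 E mulr_ge0 ?subr_ge0 ?(ltW bc)// h0 // -in_itv.
Qed.

Lemma is_derive_gt0_lt f h b c : b < c ->
  (forall x, b <= x <= c -> is_derive x 1 f (h x)) ->
  (forall x, b < x < c -> 0 < h x) -> f b < f c.
Proof.
move=> bc df h0.
have df' x : x \in `]b, c[ -> is_derive x 1 f (h x).
  by rewrite in_itv/= => /andP[bx xc]; apply: df; rewrite !ltW.
have [x xbc E] := MVT bc df' (is_derive_within_continuous df).
by rewrite -subr_gt0 E mulr_gt0 ?subr_gt0 // h0 // -in_itv.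
Qed.

Lemma powR_cvgy (r : R) : 0 < r -> x `^ r @[x --> +oo] --> +oo.
Proof.
move=> r0; apply/cvgryPge => A; near=> x.
have A0 : 0 <= Num.max A 1 by rewrite le_max ler01 orbT.
have M : Num.max A 1 `^ r^-1 <= x by near: x; exact: nbhs_pinfty_ge.
apply: (@le_trans _ _ (Num.max A 1)); first by rewrite le_max lexx.
have -> : Num.max A 1 = (Num.max A 1 `^ r^-1) `^ r.
  by rewrite -powRrM mulVf ?gt_eqF// powRr1.
by rewrite ge0_ler_powR ?(ltW r0)// ?nnegrE ?powR_ge0 // (le_trans (powR_ge0 _ _) M).
Unshelve. all: by end_near. Qed.

(** Integrating [|y^p - f y| <= d y^p] from a fixed [B] compares [F] with the primitive [P] of
    [y^p]. The constants left over at [B] are negligible because [x^(p+1)] tends to infinity. *)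
Lemma lhopital_powR f F (p : R) : -1 < p ->
  (forall x, 0 < x -> is_derive x 1 F (f x)) ->
  f x / x `^ p @[x --> +oo] --> (1 : R) ->
  F x / x `^ (p + 1) @[x --> +oo] --> (p + 1)^-1.
Proof.
move=> p1 dF cf; have p0 : 0 < p + 1 by lra.
apply/cvgrPdist_le => e e0.
(* With this [d], [d * P x] is [e / 2 * x^(p+1)]: half of the tolerance goes to the integrated
   error, the other half to the constants at [B]. *)
pose d := e * (p + 1) / 2.
have d0 : 0 < d by rewrite divr_gt0 ?mulr_gt0.
have [A [Ar HA]] : \forall x \near +oo, `|1 - f x / x `^ p| <= d.
  by move/cvgrPdist_le : cf; apply.
pose B := Num.max A 0 + 1.
have B0 : 0 < B by rewrite /B ltr_wpDl // le_max lexx orbT.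
have AB : A < B by rewrite /B ltr_pwDr // le_max lexx.
have fB x : B <= x -> `|x `^ p - f x| <= d * x `^ p.
  move=> Bx; have x0 : 0 < x := lt_le_trans B0 Bx.
  have xp := powR_gt0 p x0.
  have -> : x `^ p - f x = (1 - f x / x `^ p) * x `^ p.
    by rewrite mulrBl mul1r divfK ?gt_eqF.
  by rewrite normrM (gtr0_norm xp) ler_pM2r //; apply: HA; exact: lt_le_trans Bx.
pose P x := x `^ (p + 1) / (p + 1).
have dP x : 0 < x -> is_derive x 1 P (x `^ p).
  move=> x0; rewrite /P (_ : (fun _ => _) = (p + 1)^-1 \*: (fun y : R => y `^ (p + 1))).
    have D := is_derive1_powR (p + 1) x0; rewrite addrK in D.
    by apply: is_derive_eq; rewrite /GRing.scale/= mulKf ?gt_eqF.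
  by apply/funext => y; rewrite /= /GRing.scale/= mulrC.
have bound x : B <= x -> `|P x - F x - (P B - F B)| <= d * (P x - P B).
  move=> Bx.
  have dmix (s : R) y : B <= y <= x ->
      is_derive y 1 (d \*: P + s \*: (P - F)) (d * y `^ p + s * (y `^ p - f y)).
    move=> /andP[By _]; have y0 : 0 < y := lt_le_trans B0 By.
    have Dp := dP _ y0; have DF := dF _ y0.
    exact: is_derive_eq.
  (* The function [d P + s (P - F)] is nondecreasing beyond [B]; [s = 1] and [s = -1] give the two
     halves of the absolute value. *)
  have pos (s : R) : `|s| = 1 ->
      0 <= d * (P x - P B) + s * (P x - F x - (P B - F B)).
    move=> s1; have := is_derive_ge0_le Bx (dmix s).
    rewrite -subr_ge0 => /(_ _)/le_trans; apply.
      move=> y /andP[By _]; rewrite -lerBlDr sub0r.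
      apply: le_trans (fB y (ltW By)).
      by rewrite -[leRHS]mul1r -s1 -normrM -normrN ler_norm.
    rewrite le_eqVlt; apply/orP; left; apply/eqP.
    transitivity (d * P x + s * (P x - F x) - (d * P B + s * (P B - F B))) => //.
    ring.
  rewrite ler_norml; have := pos 1 (normr1 _); have := pos (-1) (normrN1 _); lra.
have big : \forall x \near +oo, (`|P B - F B| + d * P B) / (e / 2) <= x `^ (p + 1).
  by move/cvgryPge : (powR_cvgy p0); apply.
near=> x.
have Bx : B <= x by near: x; apply: nbhs_pinfty_ge; exact: num_real.
have x0 : 0 < x := lt_le_trans B0 Bx.
have X0 := powR_gt0 (p + 1) x0.
have -> : (p + 1)^-1 - F x / x `^ (p + 1) = (P x - F x) / x `^ (p + 1).
  by rewrite mulrBl /P -mulrA [_^-1 / _]mulrC mulrA divff ?gt_eqF// mul1r.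
rewrite normrM normfV (gtr0_norm X0) ler_pdivrMr//.
have Big : (`|P B - F B| + d * P B) / (e / 2) <= x `^ (p + 1) by near: x.
have := bound x Bx.
move: Big; rewrite ler_pdivrMr ?divr_gt0// => Big b.
have PB : 0 <= P B by rewrite /P divr_ge0 ?powR_ge0// ltW.
have dPx : d * P x = e / 2 * x `^ (p + 1).
  by rewrite /d /P; field; rewrite gt_eqF.
have T : `|P x - F x| <= `|P x - F x - (P B - F B)| + `|P B - F B|.
  by rewrite -{1}[P x - F x](subrK (P B - F B)) ler_normD.
apply: (le_trans T); apply: (le_trans (lerD b (lexx _))).
rewrite mulrBr dPx; have : 0 <= d * P B by rewrite mulr_ge0 // ltW.
move: Big; set Y := x `^ _; set Z := `|_|; set W := d * _; move=> Big W0.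
have : Z + W <= Y * (e / 2) by [].
have : Y * (e/2) + e / 2 * Y = e * Y by field.
by lra.
Unshelve. all: by end_near. Qed.

End Calculus.

(** * Scalar autonomous equations, and derivatives relative to a half-open interval *)

Section Flow.
Variable R : realType.
Implicit Types (h u v k : R -> R) (b c t x y l : R).

(** Separation of variables: [g] is the inverse of [tau], the integral of [1 / k] from [0].
    Continuity of [k] suffices, and the time [t0 = tau 1] is the one at which [g] reaches [1]. *)
Lemma autonomous_ode k : continuous k -> (forall x, 0 < k x) ->
  exists t0 g, [/\ 0 < t0, g 0 = 0,
    forall y, 0 <= y <= t0 -> is_derive y 1 g (k (g y)) &
    forall y, 0 < y <= t0 -> 0 < g y <= 1].
Proof.
move=> ck k0.
have cV : continuous (fun x => (k x)^-1).
  by move=> x; apply: continuousV; [rewrite gt_eqF|exact: ck].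
have [F dF] := continuous_antiderivative (-1) cV.
pose tau x := F x - F 0.
have dtau x : -1 < x -> is_derive x 1 tau (k x)^-1.
  move=> x1; have D := dF x x1; rewrite /tau.
  by rewrite -[(k x)^-1]subr0; apply: is_deriveB.
have tau_lt x y : -1 < x -> x < y -> tau x < tau y.
  move=> x1 xy; apply: (is_derive_gt0_lt xy) => [z /andP[xz _]|z _].
    by apply: dtau; exact: lt_le_trans xz.
  by rewrite invr_gt0.
have tau0 : tau 0 = 0 by rewrite /tau subrr.
have tau01 : 0 < tau 1 by rewrite -tau0; apply: tau_lt; rewrite ?ltrN10 ?ltr01.
have m10 : -1 < 0 :> R by rewrite ltrN10.
(* The preimage is sought among [x > -1], where [tau] is strictly increasing, hence unique; values
   outside the range get the default [0]. *)
pose g y := xget 0 [set x | -1 < x /\ tau x = y].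
have gK x : -1 < x -> g (tau x) = x.
  move=> x1; apply: xget_unique => // y [y1 E].
  case: (ltgtP x y) => [xy|yx|//].
    by have := tau_lt _ _ x1 xy; rewrite E ltxx.
  by have := tau_lt _ _ y1 yx; rewrite E ltxx.
have tau_surj y : 0 <= y <= tau 1 -> exists2 x, 0 <= x <= 1 & tau x = y.
  move=> y01.
  have [||x xI xE] := @IVT R tau 0 1 y ler01.
  - apply: is_derive_within_continuous => x /andP[x0 _].
    by apply: dtau; exact: lt_le_trans x0.
  - by rewrite tau0 min_l ?max_r ?(ltW tau01).
  by exists x => //; rewrite in_itv/= in xI.
exists (tau 1), g; split.
- exact: tau01.
- by rewrite -tau0 gK.
- move=> y /tau_surj[x /andP[x0 _] <-].
  have x1 : -1 < x by exact: lt_le_trans x0.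
  have near1 : \forall z \near x, -1 < z by exact: lt_nbhsr.
  rewrite gK //; apply: (@is_derive_eq _ _ _ _ _ _ _ (k x)^-1^-1); last first.
    by rewrite invrK.
  apply: is_derive_inverse (dtau _ x1) _; last by rewrite gt_eqF ?invr_gt0.
    by near=> z; apply: gK; near: z.
  by near=> z; apply: is_derive_continuous (dtau z _); near: z.
- move=> y /andP[y0 y1]; have [|x /andP[x0 x1] E] := tau_surj y; first by rewrite ltW.
  have -> : g y = x by rewrite -E gK // (lt_le_trans m10 x0).
  apply/andP; split=> //; rewrite lt_neqAle x0 andbT eq_sym.
  by apply: contraTneq y0 => xE; rewrite -E xE tau0 ltxx.
Unshelve. all: by end_near. Qed.

(** Even at the left endpoint [b], all points just to the right of [t] lie in the interval. This
    makes the filter of the relative derivative proper, so that its limits are unique. *)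
Let within_dnbhs_at_right b c t : b <= t < c ->
  t^'+ `=>` within `[b, c[ t^'.
Proof.
move=> /andP[bt tc] A HA.
have tcn : \forall x \near t, x < c by exact: lt_nbhsl.
have {}HA : \forall x \near t, x != t -> `[b, c[%classic x -> A x by exact: HA.
suff : \forall x \near t, t < x -> A x by [].
apply: filterS2 HA tcn => x Ax xc tx; apply: Ax; first by rewrite gt_eqF.
by rewrite /= in_itv/= (le_trans bt (ltW tx)).
Qed.

Lemma cvg_diff_quotient u v b c t l : t \in `[b, c[ ->
  {in `[b, c[, u =1 v} -> is_derive t 1 v l ->
  diff_quotient u t x @[x --> within `[b, c[ t^'] --> l.
Proof.
move=> tbc uv /is_derive1_caratheodory[h [vE ch <-]].
apply: (@cvg_trans _ (h x @[x --> within `[b, c[ t^'])).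
  apply: near_eq_cvg; rewrite near_withinE.
  near=> x => xbc; rewrite /diff_quotient !uv // vE mulfK // subr_eq0.
  by near: x; exact: nbhs_dnbhs_neq.
apply: cvg_trans ch; apply: cvg_app.
by apply: cvg_trans (@cvg_within _ _ _ _) _; exact: cvg_within.
Unshelve. all: by end_near. Qed.

Lemma is_derive_derive_within u v b c t l : t \in `[b, c[ ->
  {in `[b, c[, u =1 v} -> is_derive t 1 v l ->
  derivable_within `[b, c[ u t /\ derive_within `[b, c[ u t = l.
Proof.
move=> tbc uv dv; have H := cvg_diff_quotient tbc uv dv.
have PF : ProperFilter (within `[b, c[ t^').
  apply: Build_ProperFilter => /= H0.
  have : t^'+ (set0 : set R).
    by apply: within_dnbhs_at_right H0; rewrite in_itv/= in tbc.
  exact: filter_not_empty.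
split; first by apply/cvg_ex; exists l.
exact/cvg_lim.
Qed.

(** Ordinary derivatives restrict to relative ones, and the second derivative is continuous because
    it coincides on the interval with [h \o u]. *)
Lemma Cn_on2_is_derive u v h b c :
  (forall t, t \in `[b, c[ -> is_derive t 1 u (v t)) ->
  (forall t, t \in `[b, c[ -> is_derive t 1 v (h (u t))) ->
  continuous h ->
  Cn_on `[b, c[ 2 u /\
  forall t, t \in `[b, c[ -> derive_within_n `[b, c[ 2 u t = h (u t).
Proof.
move=> du dv ch.
have d1 t : t \in `[b, c[ ->
    derivable_within `[b, c[ u t /\ derive_within `[b, c[ u t = v t.
  by move=> tI; apply: is_derive_derive_within (du _ tI).
have d2 t : t \in `[b, c[ ->
    derivable_within `[b, c[ (derive_within `[b, c[ u) t /\
    derive_within `[b, c[ (derive_within `[b, c[ u) t = h (u t).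
  by move=> tI; apply: is_derive_derive_within (dv _ tI) => // s /d1[].
split; last by move=> t /d2[].
split.
  by move=> [|[|//]] _ t /= tI; [have [] := d1 _ tI|have [] := d2 _ tI].
apply: (@subspace_eq_continuous _ _ _ (h \o u)).
  by move=> t /set_mem /= tI; have [_ <-] := d2 _ tI.
apply: continuous_in_subspaceT => t /set_mem /= tI.
by apply: continuous_comp; [exact: is_derive_continuous (du _ tI)|exact: ch].
Qed.

End Flow.

(** * The nonlinearity, its energy and the blow-up solution *)

Section Blowup.
Variables (R : realType) (p a : R).
Hypotheses (hp : 1 < p) (ha : 1 < a).
Implicit Types (v w t T y : R).

Let q := 2 / (p - 1).

Let p10 : 0 < p - 1. Proof. by rewrite subr_gt0. Qed.
Let q0 : 0 < q. Proof. by rewrite divr_gt0. Qed.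

Let rhs v := v `^ p + log_perturbation p a v.

Let log_weight v : R := ln (2 + v ^+ 2) `^ a.

Let log_weight_gt0 v : 0 < log_weight v.
Proof.
rewrite powR_gt0 // ln_gt0 // (@lt_le_trans _ _ 2) ?ltr1n //.
by rewrite lerDl sqr_ge0.
Qed.

Let rhsE v : 0 <= v -> rhs v = v `^ p * (1 + (log_weight v)^-1).
Proof.
move=> v0; rewrite /rhs /log_perturbation ger0_norm // [_ * v]mulrC mulr_powRB1 //.
  by rewrite mulrDr mulr1.
by rewrite (lt_trans ltr01).
Qed.

Let continuous_powR v (r : R) : 0 < v -> {for v, continuous (@powR R ^~ r)}.
Proof. by move=> v0; exact: is_derive_continuous (is_derive1_powR r v0). Qed.

Let continuous_log_weight : continuous log_weight.
Proof.
move=> v; have v2 : 1 < 2 + v ^+ 2.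
  by rewrite (@lt_le_trans _ _ 2) ?ltr1n // lerDl sqr_ge0.
apply: (@continuous_comp _ _ _ (fun v => @ln R (2 + v ^+ 2)) (@powR R ^~ a));
  last first.
  by apply: continuous_powR; rewrite ln_gt0.
apply: (@continuous_comp _ _ _ (fun v : R => 2 + v ^+ 2) (@ln R)); last first.
  by apply: continuous_ln; rewrite (lt_trans ltr01).
by apply: cvgD; [exact: cvg_cst|exact: exprn_continuous].
Qed.

(* The profile only takes values at least 1, so the right-hand side may be
   frozen below 1, which makes it continuous and positive on the whole line. *)
Let h v := rhs (Num.max v 1).

Let h_continuous : continuous h.
Proof.
have max1 v : 0 < Num.max v 1 by rewrite lt_max ltr01 orbT.
rewrite /h (_ : (fun _ => _) = fun v =>
   Num.max v 1 `^ p * (1 + (log_weight (Num.max v 1))^-1)); last first.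
  by apply/funext => v; rewrite rhsE // ltW.
move=> v.
have cm : {for v, continuous (fun v => Num.max v 1)}.
  by apply: continuous_max; [exact: cvg_id|exact: cvg_cst].
apply: (@continuous_comp _ _ _ (fun v => Num.max v 1)
  (fun v => v `^ p * (1 + (log_weight v)^-1))) => //.
apply: cvgM; first exact: continuous_powR.
apply: cvgD; first exact: cvg_cst.
by apply: cvgV; [rewrite gt_eqF|exact: continuous_log_weight].
Qed.

Let h_gt0 v : 0 < h v.
Proof.
have max1 : 0 < Num.max v 1 by rewrite lt_max ltr01 orbT.
by rewrite /h rhsE ?(ltW max1)// mulr_gt0 ?powR_gt0// ltr_wpDl // invr_gt0.
Qed.

(** For [v >= 1] the quotient is [1 + 1 / log_weight v], and the logarithmic weight tends to
    infinity. *)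
Let h_asymp : h v / v `^ p @[v --> +oo] --> (1 : R).
Proof.
have lnoo : @ln R (2 + v ^+ 2) @[v --> +oo] --> +oo.
  apply/cvgryPge => A; near=> v.
  have v1 : 1 <= v by near: v; apply: nbhs_pinfty_ge; exact: num_real.
  have vA : expR A <= v by near: v; apply: nbhs_pinfty_ge; exact: num_real.
  have V : v <= 2 + v ^+ 2 by nra.
  rewrite -ler_expR lnK ?posrE; first exact: le_trans V.
  by rewrite (lt_le_trans _ V) // (lt_le_trans ltr01).
have woo : log_weight v @[v --> +oo] --> +oo.
  apply: (@cvg_comp _ _ _ (fun v => ln (2 + v ^+ 2)) (@powR R ^~ a) _ +oo) => //.
  by apply: powR_cvgy; rewrite (lt_trans ltr01).
have w0 : (log_weight v)^-1 @[v --> +oo] --> 0.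
  by apply/(gtr0_cvgV0 (nearW _ _)).2.
rewrite -[1]addr0.
apply: cvg_trans (cvgD (cvg_cst (1 : R)) w0).
apply: near_eq_cvg; near=> v.
have v1 : 1 <= v by near: v; apply: nbhs_pinfty_ge; exact: num_real.
have v0 : 0 < v := lt_le_trans ltr01 v1.
by rewrite /h max_l // rhsE ?(ltW v0)// mulrAC divff ?mul1r // gt_eqF ?powR_gt0.
Unshelve. all: by end_near. Qed.

Let energy : exists F : R -> R,
  [/\ forall v, 0 < v -> is_derive v 1 F (h v),
      forall v, 0 < v -> 0 < F v &
      F v / v `^ (p + 1) @[v --> +oo] --> (p + 1)^-1].
Proof.
have [F0 dF0] := continuous_antiderivative (-1) h_continuous.
(* This normalization gives [F 0 = 1]; as [h > 0], [F] then stays positive on the right of [0]. *)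
pose F v := F0 v - F0 0 + 1.
have m10 : -1 < 0 :> R by rewrite ltrN10.
have dF v : 0 <= v -> is_derive v 1 F (h v).
  move=> v0; have D := dF0 v (lt_le_trans m10 v0).
  by rewrite /F -[h v]addr0; apply: is_deriveD; rewrite -[h v]subr0; apply: is_deriveB.
exists F; split=> [v v0|v v0|]; first exact/dF/ltW.
  have : F 0 <= F v.
    apply: (is_derive_ge0_le (ltW v0)) => [y /andP[y0 _]|y _]; first exact: dF.
    exact: ltW.
  by rewrite {1}/F subrr add0r; apply: lt_le_trans.
apply: lhopital_powR h_asymp; first by rewrite (lt_trans m10)// (lt_trans ltr01).
by move=> v v0; exact/dF/ltW.
Qed.

Let powRNq_cvgy : w `^ (- q) @[w --> 0^'+] --> +oo.
Proof.
rewrite (_ : (fun _ => _) = (fun w => (w `^ q)^-1)); last first.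
  by apply/funext => w; rewrite powRN.
apply/(@cvgrVy _ _ (0^'+) _ (@powR R ^~ q)); last exact: powR_cvg0.
by near=> w; rewrite powR_gt0.
Unshelve. all: by end_near. Qed.

(** Substituting [u = w^(-q)] in [u' = sqrt (2 F(u))] gives
    [- w' = q^-1 sqrt (2 F(w^(-q))) w^(q+1)]. The limit of [F(u) / u^(p+1)] removes the apparent
    singularity at [w = 0]. *)
Let speed (F : R -> R) : (forall v, 0 < v -> is_derive v 1 F (h v)) ->
  (forall v, 0 < v -> 0 < F v) ->
  F v / v `^ (p + 1) @[v --> +oo] --> (p + 1)^-1 ->
  exists k : R -> R, [/\ continuous k, forall w, 0 < k w,
    k 0 = q^-1 * Num.sqrt (2 / (p + 1)) &
    forall w, 0 < w -> k w = q^-1 * (Num.sqrt (2 * F (w `^ (- q))) * w `^ (q + 1))].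
Proof.
move=> dF F0 limF.
have p1 : 0 < p + 1 by rewrite addr_gt0 // (lt_trans ltr01).
pose m0 w := F (w `^ (- q)) / (w `^ (- q)) `^ (p + 1).
(* Freezing the limit value on [w <= 0] keeps [m] continuous and positive on the whole line, as
   [autonomous_ode] requires of the speed. *)
pose m w := if 0 < w then m0 w else (p + 1)^-1.
have m_gt0 w : 0 < m w.
  by rewrite /m; case: ifPn => w0; rewrite ?invr_gt0// divr_gt0 ?F0// ?powR_gt0.
have cm : continuous m.
  move=> w; case: (ltgtP 0 w) => [w0|w0|<-].
  - have : m0 x @[x --> w] --> m w.
      rewrite /m w0; have wq0 := powR_gt0 (- q) w0.
      apply: (@continuous_comp _ _ _ (@powR R ^~ (- q))
        (fun v => F v / v `^ (p + 1))); first exact: continuous_powR.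
      apply: cvgM; first exact: is_derive_continuous (dF _ wq0).
      by apply: cvgV; [rewrite gt_eqF ?powR_gt0|exact: continuous_powR].
    apply: cvg_trans; apply: near_eq_cvg.
    by near=> x; rewrite /m ifT //; near: x; exact: lt_nbhsr.
  - have : (p + 1)^-1 @[x --> w] --> m w by rewrite /m ltNge (ltW w0); exact: cvg_cst.
    apply: cvg_trans; apply: near_eq_cvg.
    near=> x; rewrite /m ifF //; apply/negbTE; rewrite -leNgt; apply: ltW.
    by near: x; exact: lt_nbhsl.
  - have c0 : m0 x @[x --> 0^'+] --> (p + 1)^-1 := cvg_comp _ _ powRNq_cvgy limF.
    have m00 : m 0 = (p + 1)^-1 by rewrite /m ltxx.
    apply/cvgrPdist_le => e e0; rewrite m00.
    have H : \forall x \near 0, 0 < x -> `|(p + 1)^-1 - m0 x| <= e.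
      by move/cvgrPdist_le : c0 => /(_ _ e0).
    near=> x; rewrite /m; case: ifPn => x0; last by rewrite subrr normr0 ltW.
    by move: x0; near: x.
exists (fun w => q^-1 * Num.sqrt (2 * m w)); split.
- move=> w; apply: cvgM; first exact: cvg_cst.
  apply: (@continuous_comp _ _ _ (fun w => 2 * m w) Num.sqrt); last first.
    exact: sqrt_continuous.
  by apply: cvgM; [exact: cvg_cst|exact: cm].
- by move=> w; rewrite mulr_gt0 ?invr_gt0// sqrtr_gt0 mulr_gt0.
- by rewrite /m ltxx.
- move=> w w0; rewrite /m w0 /m0; congr (_ * _).
  have W0 := powR_gt0 (q + 1) w0.
  (* The choice [q = 2 / (p - 1)] gives [q (p + 1) = 2 (q + 1)], so the power leaves the square root
     exactly. *)
  have -> : (w `^ (- q)) `^ (p + 1) = (w `^ (q + 1)) ^- 2.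
    rewrite -powRrM -powR_invn ?ltW// -powRrM; congr (_ `^ _).
    by rewrite /q; field; rewrite gt_eqF.
  rewrite invrK mulrA sqrtrM ?mulr_ge0 ?(ltW (F0 _ (powR_gt0 _ w0)))//.
  by rewrite sqrtr_sqr gtr0_norm.
Unshelve. all: by end_near. Qed.

(** The base on the right is the speed [k 0] at blow-up: from [w ~ k(0) (T - t)] the constant of
    [u = w^(-q)] is [k(0)^(-q)]. *)
Let kappa0E : kappa0 p = (q^-1 * Num.sqrt (2 / (p + 1))) `^ (- q).
Proof.
have p1 : 0 < p + 1 by rewrite addr_gt0 // (lt_trans ltr01).
have K0 : 0 < q^-1 * Num.sqrt (2 / (p + 1)).
  by rewrite mulr_gt0 ?invr_gt0// sqrtr_gt0 divr_gt0.
have -> : - q = 2 * - (p - 1)^-1 by rewrite /q mulrN.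
rewrite powRrM powR_mulrn ?(ltW K0)// exprMn sqr_sqrtr; last by rewrite divr_ge0 // ltW.
have -> : q^-1 ^+ 2 * (2 / (p + 1)) = (2 * (p + 1) / (p - 1) ^+ 2)^-1.
  by rewrite /q; field; rewrite !gt_eqF.
rewrite -powR_inv1; last by rewrite divr_ge0 ?mulr_ge0 ?sqr_ge0 // ltW.
by rewrite -powRrM mulN1r opprK.
Qed.

(** The equation is autonomous, so all blow-up times are treated at once, with [t0] independent of
    [T]; the unshifted solution is the case [T = 0]. *)
Lemma blowup_solution_exists : exists (t0 : R) (phi0 : R -> R), 0 < t0 /\
  forall T, let phiT := fun t => phi0 (t - T) in
    [/\ Cn_on `[T - t0, T[ 2 phiT, solves_ode p a `[T - t0, T[ phiT &
        asymp_equiv T^'- phiT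
          (fun t => kappa0 p * (T - t) `^ (- (2 / (p - 1))))].
Proof.
have [F [dF F0 limF]] := energy.
have [k [ck k_gt0 k0E kE]] := speed dF F0 limF.
have [t0 [g [t0_gt0 g0 dg g01]]] := autonomous_ode ck k_gt0.
(* The flow [g] runs in the time remaining before blow-up, so [w(t) = g (- t)] decreases to [0]. *)
exists t0, (fun t => g (- t) `^ (- q)); split => // T phiT.
have phiTE t : phiT t = g (T - t) `^ (- q) by rewrite /phiT opprB.
have dom t : t \in `[T - t0, T[ -> 0 < T - t <= t0.
  by rewrite in_itv/= => /andP[t1 t2]; rewrite subr_gt0 t2 lerBlDl -lerBlDr.
have g_gt0 t : t \in `[T - t0, T[ -> 0 < g (T - t) by move=> /dom/g01/andP[].
have phiT_gt0 t : t \in `[T - t0, T[ -> 0 < phiT t.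
  by move=> /g_gt0; rewrite phiTE; exact: powR_gt0.
(* Since [g <= 1] and the exponent is negative, the solution stays where [h] agrees with [rhs]. *)
have phiT_ge1 t : t \in `[T - t0, T[ -> 1 <= phiT t.
  move=> tI; have /andP[y0 y1] := g01 _ (dom _ tI).
  rewrite phiTE -(powRr0 (g (T - t))); apply: ger_powR; first by rewrite y0.
  by rewrite oppr_le0 ltW.
pose v t := Num.sqrt (2 * F (phiT t)).
have dphi t : t \in `[T - t0, T[ -> is_derive t 1 phiT (v t).
  move=> tI; have /andP[y0 y1] := dom _ tI.
  have y01 : 0 <= T - t <= t0 by rewrite ltW.
  have dTt : is_derive t (1 : R) (fun t => T - t) (-1).
    by rewrite -sub0r; apply: is_deriveB.
  have dgT := @is_derive1_comp R g (fun t => T - t) t _ _ (dg _ y01) dTt.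
  have dP := @is_derive1_comp R (@powR R ^~ (- q)) (g \o (fun t => T - t)) t _ _
    (is_derive1_powR (- q) (g_gt0 _ tI)) dgT.
  rewrite (_ : phiT = (@powR R ^~ (- q)) \o (g \o (fun t => T - t))); last first.
    by apply/funext => s; rewrite phiTE.
  (* The signs from [- q] and from reversing time cancel, and the factor [q^-1 g^(q+1)] in [k]
     cancels [q g^(-q-1)]. *)
  apply: (@is_derive_eq _ _ _ _ _ _ _ _ dP).
  have G := g_gt0 _ tI.
  rewrite kE // /v phiTE -opprD powRN.
  have qn0 : q != 0 by rewrite gt_eqF.
  have Gn0 : g (T - t) `^ (q + 1) != 0 by rewrite gt_eqF // powR_gt0.
  by field; rewrite qn0 Gn0.
(* Differentiating [v = sqrt (2 F(phiT))] gives [h(phiT) phiT' / v], and [phiT' = v]. *)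
have dv t : t \in `[T - t0, T[ -> is_derive t 1 v (h (phiT t)).
  move=> tI; have F1 := F0 _ (phiT_gt0 _ tI).
  have F2 : 0 < 2 * F (phiT t) by rewrite mulr_gt0.
  have dFp := @is_derive1_comp R F phiT t _ _ (dF _ (phiT_gt0 _ tI)) (dphi _ tI).
  have d2F : is_derive t 1 (2 \*: (F \o phiT)) (2 *: (h (phiT t) * v t)).
    exact: is_deriveZ.
  have D := @is_derive1_comp R Num.sqrt (2 \*: (F \o phiT)) t _ _
    (is_derive1_sqrt F2) d2F.
  apply: (@is_derive_eq _ _ _ _ _ _ _ _ D).
  have v0 : v t != 0 by rewrite gt_eqF // sqrtr_gt0.
  rewrite /GRing.scale/= -/(v t).
  by field.
have [C2 d2] := Cn_on2_is_derive dphi dv h_continuous.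
split=> //.
  move=> t tI; split; first by rewrite ltW // phiT_gt0.
  by rewrite d2 // /h max_l // phiT_ge1.
have t00 : 0 <= (0 : R) <= t0 by apply/andP; split=> //; exact: ltW.
(* As [g 0 = 0], this writes [g y = c y * y] with [c] continuous at [0] and [c 0 = k 0]; the
   quotient with the expected profile is then exactly [(c (T - t) / k 0)^(-q)] near [T]. *)
have /is_derive1_caratheodory[c [gc cc c0]] := dg 0 t00.
rewrite g0 in c0.
rewrite /asymp_equiv.
apply: (@cvg_trans _ ((c (T - t) / k 0) `^ (- q) @[t --> T^'-])).
  apply: near_eq_cvg; near=> t.
  have y0 : 0 < T - t by rewrite subr_gt0; near: t; exact: nbhs_left_lt.
  have tI : t \in `[T - t0, T[.
    rewrite in_itv/= -subr_gt0 y0 andbT; apply: ltW.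
    by near: t; apply: nbhs_left_gt; rewrite ltrBlDr ltrDl.
  have gE : g (T - t) = c (T - t) * (T - t) by have := gc (T - t); rewrite g0 !subr0.
  have c_gt0 : 0 < c (T - t) by have := g_gt0 _ tI; rewrite gE pmulr_lgt0.
  have ky0 : 0 < k 0 * (T - t) by rewrite mulr_gt0.
  rewrite phiTE gE kappa0E -k0E -powRM ?(ltW y0) ?(ltW (k_gt0 _))//.
  have -> : c (T - t) * (T - t) = c (T - t) / k 0 * (k 0 * (T - t)).
    by rewrite mulrA divfK ?gt_eqF.
  rewrite [(_ / _ * _) `^ _]powRM ?(ltW ky0) ?divr_ge0 ?(ltW c_gt0) ?(ltW (k_gt0 _))//.
  by rewrite mulfK // gt_eqF // powR_gt0.
have -> : (1 : R) = (c (T - T) / k 0) `^ (- q).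
  by rewrite subrr c0 divff ?gt_eqF// powR1.
apply: cvg_at_left_filter.
apply: (@continuous_comp _ _ _ (fun t => c (T - t) / k 0) (@powR R ^~ (- q))).
  apply: cvgM; last exact: cvg_cst.
  apply: (@continuous_comp _ _ _ (fun t => T - t) c); last by rewrite subrr.
  by apply: cvgB; [exact: cvg_cst|exact: cvg_id].
by apply: continuous_powR; rewrite subrr c0 divff ?gt_eqF.
Unshelve. all: by end_near. Qed.

End Blowup.

(** * Similarity variables and conclusion *)

(** The map [s = - ln (T - t)] is a bijection from the time interval onto the half-line
    [s >= - ln t0], with inverse [t = T - expR (- s)]. *)
Lemma similarity_profileE (R : realType) (p T t0 : R) (u phi : R -> R) : 0 < t0 ->
  similarity_profile p T `[T - t0, T[ u phi <->
  forall s, - ln t0 <= s ->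
    phi s = expR (- (2 * s / (p - 1))) * u (T - expR (- s)).
Proof.
move=> t0_gt0; split=> [H s s0|H t]; last first.
  rewrite /= in_itv/= => /andP[t1 t2].
  have y0 : 0 < T - t by rewrite subr_gt0.
  rewrite H; last by rewrite lerN2 ler_ln ?posrE // lerBlDl -lerBlDr.
  rewrite opprK lnK ?posrE // subKr /powR gt_eqF //; congr (expR _ * _).
  by ring.
have := H (T - expR (- s)); rewrite subKr expRK opprK => ->.
  rewrite /powR gt_eqF ?expR_gt0 // expRK; congr (expR _ * _); ring.
rewrite /= in_itv/= ltrBlDr ltrDl expR_gt0 andbT lerB //.
by rewrite -[leRHS]lnK ?posrE // ler_expR lerNl.
Qed.

Theorem lemmaA1 (R : realType) (p a : R) (hp : 1 < p) (ha : 1 < a) :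
  exists (t0 : R) (phi0 : R -> R),
    (* (i) *)
    [/\ 0 < t0,
        Cn_on `[- t0, 0[ 2 phi0,
        solves_ode p a `[- t0, 0[ phi0 &
        asymp_equiv 0^'- phi0
          (fun t => kappa0 p * (- t) `^ (- (2 / (p - 1))))] /\
    forall T : R,
      let phiT := fun t : R => phi0 (t - T) in
      (* (ii) *)
      [/\ Cn_on `[T - t0, T[ 2 phiT,
          solves_ode p a `[T - t0, T[ phiT &
          asymp_equiv T^'- phiT
            (fun t => kappa0 p * (T - t) `^ (- (2 / (p - 1))))] /\
      (* (iii) *)
      forall phi : R -> R,
        similarity_profile p T `[T - t0, T[ phiT phi <->
        forall s : R, - ln t0 <= s ->
          phi s = expR (- (2 * s / (p - 1))) * phiT (T - expR (- s)) /\
          phi s = expR (- (2 * s / (p - 1))) * phi0 (- expR (- s)).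
Proof.
have [t0 [phi0 [t0_gt0 H]]] := blowup_solution_exists hp ha.
exists t0, phi0; split.
  have := H 0; rewrite /= sub0r.
  rewrite (_ : (fun t => phi0 (t - 0)) = phi0); last first.
    by apply/funext => t; rewrite subr0.
  rewrite (_ : (fun t => kappa0 p * (0 - t) `^ (- (2 / (p - 1)))) =
    (fun t => kappa0 p * (- t) `^ (- (2 / (p - 1))))); last first.
    by apply/funext => t; rewrite sub0r.
  by case.
move=> T; split; first exact: H.
move=> phi; rewrite similarity_profileE //.
split=> E s /E; last by case.
by move=> ->; split=> //; rewrite addrAC subrr sub0r.
Qed.
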